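(* Let $(A^+,\mathfrak{p})$ be a semi-valuation ring with semi-fraction ring $A=A^+_{\mathfrak{p}}$ such that $A$ is not finitely generated as a module over $A^+$ and such that there exist elements $X,Y\in\mathfrak{p}$ which form a regular sequence in $A$. Then the ring $A^+$ is not coherent.
   Context: All rings are commutative with unit. A valuation on a ring $R$ is a map $|-|\colon R\to\Gamma\cup\{0\}$, with $\Gamma$ a totally ordered multiplicative abelian group, such that $|0|=0$, $|1|=1$, $|xy|=|x||y|$, $|x+y|\le\max\{|x|,|y|\}$ (conventions $0\cdot\gamma=0$, $0<\gamma$ for $\gamma\in\Gamma$); its support is the prime ideal $|-|^{-1}(0)$. A semi-valuation ring is a ring $A^+$ with a valuation $|-|$ such that (1) every zero divisor of $A^+$ lies in the support of $|-|$ and (2) for all $x,y\in A^+$ with $|x|\le|y|\ne 0$ one has $y\mid x$ in $A^+$. One writes it as $(A^+,\mathfrak{p})$ where $\mathfrak{p}$ is the support of $|-|$. The local ring $A=A^+_{\mathfrak{p}}$ is its semi-fraction ring; the map $A^+\to A$ is injective and identifies $\mathfrak{p}$ with the maximal ideal of $A$. A ring is coherent if every finitely generated ideal is finitely presented. *)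

(* Defs.v *)
From HB Require Import structures.
From mathcomp Require Import all_boot all_order all_algebra.
From mathcomp Require Import boolp classical_sets.

Set Implicit Arguments.
Unset Strict Implicit.
Unset Printing Implicit Defensive.

Import Order.TTheory GRing.Theory.
Local Open Scope classical_set_scope.
Local Open Scope ring_scope.

HB.mixin Record isOrderedAbelian (d : Order.disp_t) (G : Type)
    of Group G & Order.Total d G := {
  oag_mulC : forall x y : G, (x * y)%g = (y * x)%g;
  oag_leM2l : forall x y z : G, (x <= y)%O -> ((z * x)%g <= (z * y)%g)%O
}.

#[short(type="ordAbelianGroupType")]
HB.structure Definition OrdAbelianGroup (d : Order.disp_t) :=
  { G of isOrderedAbelian d G & Group G & Order.Total d G }.

(* [with0 G] is G with an absorbing element 0 adjoined below G; 0 is [None]. *)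
Definition with0 (G : Type) : Type := option G.

Section With0.
Variables (d : Order.disp_t) (G : ordAbelianGroupType d).

Definition w0_zero : with0 G := None.
Definition w0_one : with0 G := Some 1%g.
Definition w0_mul (a b : with0 G) : with0 G :=
  if a is Some g then if b is Some h then Some (g * h)%g else None else None.
Definition w0_le (a b : with0 G) : bool :=
  if a is Some g then if b is Some h then (g <= h)%O else false else true.

Fact w0_le_refl : reflexive w0_le.
Proof. by case=> [g|] //=. Qed.

Fact w0_le_anti : antisymmetric w0_le.
Proof. by move=> [g|] [h|] //= /le_anti ->. Qed.

Fact w0_le_trans : transitive w0_le.
Proof. by move=> [g|] [h|] [k|] //=; apply: le_trans. Qed.

Fact w0_le_total : total w0_le.
Proof. by move=> [g|] [h|] //=; apply: le_total. Qed.

HB.instance Definition _ := Choice.copy (with0 G) (option G).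
HB.instance Definition _ := Order.Le_isPOrder.Build d (with0 G)
  w0_le_refl w0_le_anti w0_le_trans.
HB.instance Definition _ := Order.POrder_isTotal.Build d (with0 G) w0_le_total.

End With0.

Record valuation (d : Order.disp_t) (G : ordAbelianGroupType d)
    (R : comNzRingType) := Valuation {
  val_fun :> R -> with0 G;
  val0 : val_fun 0 = w0_zero G;
  val1 : val_fun 1 = w0_one G;
  valM : forall x y : R, val_fun (x * y) = w0_mul (val_fun x) (val_fun y);
  valD : forall x y : R,
    (val_fun (x + y) <= Order.max (val_fun x) (val_fun y))%O
}.

Definition val_support (d : Order.disp_t) (G : ordAbelianGroupType d)
    (R : comNzRingType) (v : valuation G R) : set R :=
  [set x | v x = w0_zero G].

Definition zero_divisor (R : comNzRingType) (x : R) : Prop :=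
  exists2 y : R, y != 0 & x * y = 0.

Definition is_semi_valuation_ring (d : Order.disp_t)
    (G : ordAbelianGroupType d) (R : comNzRingType) (v : valuation G R) : Prop :=
  (forall x : R, zero_divisor x -> val_support v x) /\
  (forall x y : R, (v x <= v y)%O -> v y <> w0_zero G ->
     exists z : R, x = y * z).

(* The R-algebra A, with structure map x |-> x%:A, is the localization S^-1 R:
   elements of S become invertible, every element of A is a fraction x / s, and
   x, y have the same image exactly when they agree up to a factor in S (the
   converse of the last clause follows from the first one). *)
Definition is_localization (R : comNzRingType) (S : set R)
    (A : comAlgType R) : Prop :=
  [/\ forall s : R, S s -> exists b : A, s%:A * b = 1,
      forall a : A, exists x s : R, S s /\ a * s%:A = x%:A
    & forall x y : R, x%:A = y%:A :> A -> exists s : R, S s /\ s * x = s * y].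

(* A is the localization of R at the support of v. *)
Definition is_semi_fraction_ring (d : Order.disp_t)
    (G : ordAbelianGroupType d) (R : comNzRingType) (v : valuation G R)
    (A : comAlgType R) : Prop :=
  is_localization (~` val_support v) A.

Definition span (R : comNzRingType) (M : lmodType R) (n : nat)
    (e : 'I_n -> M) : set M :=
  [set m | exists c : 'rV[R]_n, m = \sum_(i < n) c 0 i *: e i].

Definition relations (R : comNzRingType) (M : lmodType R) (n : nat)
    (e : 'I_n -> M) : set 'rV[R]_n :=
  [set c | \sum_(i < n) c 0 i *: e i = 0].

(* Both predicates below force N to be a submodule of M. *)
Definition finitely_generated (R : comNzRingType) (M : lmodType R)
    (N : set M) : Prop :=
  exists (n : nat) (e : 'I_n -> M), N = span e.

(* N has a presentation R^m -> R^n -> N -> 0. *)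
Definition finitely_presented (R : comNzRingType) (M : lmodType R)
    (N : set M) : Prop :=
  exists (n : nat) (e : 'I_n -> M),
    N = span e /\ finitely_generated (relations e).

(* Ideals of R are the submodules of the regular module R^o. *)
Definition coherent (R : comNzRingType) : Prop :=
  forall I : set R^o, finitely_generated I -> finitely_presented I.

(* Each s_i is a non-zero-divisor modulo (s_0, ..., s_(i-1)), and s generates a
   proper ideal. *)
Definition regular_sequence (A : comNzRingType) (s : seq A) : Prop :=
  let ideal (t : seq A) : set A^o :=
    span (fun i : 'I_(size t) => t`_i : A^o) in
  (forall (i : nat) (a : A), (i < size s)%N ->
     ideal (take i s) (s`_i * a) -> ideal (take i s) a) /\
  ~ ideal s 1.

(* Main.v *)
Require Import Defs.
From HB Require Import structures.
From mathcomp Require Import all_boot all_order all_algebra.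
From mathcomp Require Import boolp classical_sets.

(** Write R for the semi-valuation ring and p for the support of its valuation.
    Every element of p is divisible in R by every element outside p, so p
    absorbs multiplication by A = R_p ([support_absorbs_fractions]), while R
    itself embeds into A ([semi_fraction_inj]).  Consider the ideal (X, Y) of R.
    A syzygy (c, d) of (X, Y) satisfies d Y = - c X in A, so regularity of the
    sequence gives d = X a for some a in A, and then c = - Y a.  Conversely,
    for each a in A the pair (- Y a, X a) has its entries in R, because X and Y
    lie in p, and it is a syzygy.  The syzygy module of (X, Y) is
    thus isomorphic to A, which is not finitely generated over R.

    If R were coherent, (X, Y) would have some finite presentation.  By
    Schanuel's argument ([relations_fg_change_generators]) the syzygies of the
    particular generators X, Y would then be finitely generated as well, a
    contradiction. *)

Set Implicit Arguments.
Unset Strict Implicit.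
Unset Printing Implicit Defensive.

Import Order.TTheory GRing.Theory.
Local Open Scope classical_set_scope.
Local Open Scope ring_scope.

Local Notation span := Defs.span.

Section LinearCombinations.
Variables (R : comNzRingType) (M : lmodType R).

Definition lincomb (n : nat) (e : 'I_n -> M) (c : 'rV[R]_n) : M :=
  \sum_(i < n) c 0 i *: e i.

Lemma lincombD n (e : 'I_n -> M) (c c' : 'rV[R]_n) :
  lincomb e (c + c') = lincomb e c + lincomb e c'.
Proof.
by rewrite /lincomb -big_split; apply: eq_bigr => i _; rewrite mxE scalerDl.
Qed.

Lemma lincombZ n (e : 'I_n -> M) a (c : 'rV[R]_n) :
  lincomb e (a *: c) = a *: lincomb e c.
Proof.
by rewrite /lincomb scaler_sumr; apply: eq_bigr => i _; rewrite mxE scalerA.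
Qed.

Lemma lincombB n (e : 'I_n -> M) (c c' : 'rV[R]_n) :
  lincomb e (c - c') = lincomb e c - lincomb e c'.
Proof. by rewrite lincombD -(scaleN1r c') lincombZ scaleN1r. Qed.

Lemma lincomb_sum n (e : 'I_n -> M) k (d : 'I_k -> R) (g : 'I_k -> 'rV[R]_n) :
  lincomb e (\sum_(j < k) d j *: g j) = \sum_(j < k) d j *: lincomb e (g j).
Proof.
apply: (big_ind2 (fun c m => lincomb e c = m)).
- by rewrite /lincomb big1 // => i _; rewrite mxE scale0r.
- by move=> c m c' m' <- <-; rewrite lincombD.
- by move=> j _; rewrite lincombZ.
Qed.

Lemma lincomb_delta n (e : 'I_n -> M) i : lincomb e (delta_mx 0 i) = e i.
Proof.
rewrite /lincomb (bigD1 i) //= mxE !eqxx scale1r big1 ?addr0 // => j /negPf ji.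
by rewrite mxE ji andbF scale0r.
Qed.

Lemma span_gen n (e : 'I_n -> M) i : span e (e i).
Proof. by exists (delta_mx 0 i); exact/esym/lincomb_delta. Qed.

(** The inclusion of span e into span f lifts to a linear map, given by a
    matrix, between the free modules that cover them. *)
Lemma change_generators n m (e : 'I_n -> M) (f : 'I_m -> M) :
  span e `<=` span f ->
  exists P : 'M[R]_(n, m), forall c, lincomb f (c *m P) = lincomb e c.
Proof.
move=> ef; have /choice[p pE] i : exists c, e i = lincomb f c.
  exact: ef (span_gen e i).
exists (\matrix_i p i) => c; rewrite mulmx_sum_row lincomb_sum.
by apply: eq_bigr => i _; rewrite rowK -pE.
Qed.

End LinearCombinations.

(** Schanuel's argument.  Let P and Q be matrices that express e through f and
    f through e.  A relation c of f decomposes as c Q P + c (1 - Q P).  Here c Q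
    is a relation of e, so c Q P comes from the generators of those; and the
    rows of 1 - Q P are relations of f, because Q P induces the identity on the
    module. *)
Lemma relations_fg_change_generators (R : comNzRingType) (M : lmodType R)
    (n m : nat) (e : 'I_n -> M) (f : 'I_m -> M) :
  span e = span f ->
  finitely_generated (relations e) -> finitely_generated (relations f).
Proof.
move=> ef [k [r rE]].
have [P PE] : exists P : 'M[R]_(n, m),
    forall c, lincomb f (c *m P) = lincomb e c.
  by apply: change_generators; rewrite ef.
have [Q QE] : exists Q : 'M[R]_(m, n),
    forall c, lincomb e (c *m Q) = lincomb f c.
  by apply: change_generators; rewrite ef.
pose g (i : 'I_(k + m)) : 'rV[R]_m :=
  match split i with inl j => r j *m P | inr j => row j (1%:M - Q *m P) end.
have gl j : g (lshift m j) = r j *m P.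
  by rewrite /g (unsplitK (inl j)).
have gr j : g (rshift k j) = row j (1%:M - Q *m P).
  by rewrite /g (unsplitK (inr j)).
have grel i : lincomb f (g i) = 0.
  rewrite /g; case: (split i) => j.
    by rewrite PE; have := span_gen r j; rewrite -rE.
  rewrite rowE mulmxBr mulmx1 mulmxA lincombB PE QE.
  exact: subrr.
exists (k + m)%N, g; apply/seteqP; split=> [c cf|c [b ->]]; last first.
  change (lincomb f (\sum_(i < k + m) b 0 i *: g i) = 0).
  by rewrite lincomb_sum big1 // => i _; rewrite grel scaler0.
have [b bE] : span r (c *m Q).
  by rewrite -rE; change (lincomb e (c *m Q) = 0); rewrite QE.
exists (row_mx b c); rewrite big_split_ord /=.
under eq_bigr => j _ do rewrite row_mxEl gl.
under [X in _ + X]eq_bigr => j _ do rewrite row_mxEr gr.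
rewrite -mulmx_sum_row mulmxBr mulmx1 mulmxA bE mulmx_suml.
under [X in _ = X + _]eq_bigr => j _ do rewrite scalemxAl.
by rewrite addrC subrK.
Qed.

Section SemiFractionRing.
Variables (d : Order.disp_t) (G : ordAbelianGroupType d).
Variables (R : comNzRingType) (v : valuation G R).
Hypothesis hv : is_semi_valuation_ring v.
Variable A : comAlgType R.
Hypothesis hA : is_semi_fraction_ring v A.

(** The denominators lie outside the support, hence are not zero divisors. *)
Lemma semi_fraction_inj : injective (fun x : R => x%:A : A).
Proof.
case: hA => _ _ inj x y /inj[s [sS sxy]]; apply/eqP/negPn/negP => xy.
apply: sS; apply: hv.1; exists (x - y); first by rewrite subr_eq0.
by rewrite mulrBr sxy subrr.
Qed.

(** A denominator s has larger value than X, so X = s z for some z and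
    (x / s) X = x z. *)
Lemma support_absorbs_fractions (X : R) (a : A) :
  val_support v X -> exists z : R, X *: a = z%:A.
Proof.
move=> X0; case: hA => _ frac _; have [x [s [sS as_x]]] := frac a.
have [z ->] : exists z, X = s * z by apply: hv.2; rewrite ?X0.
by exists (z * x); rewrite mulrC -!scalerA -as_x -scalerAr mulr1.
Qed.

End SemiFractionRing.

(** The ideals in the definition of regularity are those spanned by the empty
    family and by x alone, which are 0 and x A. *)
Lemma regular_pair (A : comNzRingType) (x y : A) :
  regular_sequence [:: x; y] ->
  (forall a, x * a = 0 -> a = 0) /\
  (forall a b, y * a = b * x -> exists b', a = b' * x).
Proof.
case=> reg _; split=> [a xa|a b yab].
  have /= := reg 0 a isT; rewrite xa => -[|c ->]; last by rewrite big_ord0.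
  by exists 0; rewrite big_ord0.
have /= := reg 1 a isT; rewrite yab => -[|c ->].
  by exists (const_mx b); rewrite big_ord1 mxE.
by exists (c 0 0); rewrite big_ord1.
Qed.

Theorem lemma3p11 (d : Order.disp_t) (G : ordAbelianGroupType d)
    (Aplus : comNzRingType) (v : valuation G Aplus)
    (hv : is_semi_valuation_ring v)
    (A : comAlgType Aplus) (hA : is_semi_fraction_ring v A)
    (hfg : ~ finitely_generated [set: A])
    (hreg : exists X Y : Aplus,
       [/\ val_support v X, val_support v Y
         & regular_sequence [:: X%:A; Y%:A : A]]) :
  ~ coherent Aplus.
Proof.
move=> coh; apply: hfg; case: hreg => X [Y [X0 Y0 /regular_pair[regX regY]]].
have regXZ (a : A) : X *: a = 0 -> a = 0.
  by move=> Xa; apply: regX; rewrite -scalerAl mul1r.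
pose e (i : 'I_2) : Aplus^o := [:: X; Y]`_i.
have relE c : lincomb e c = c 0 0 * X + c 0 1 * Y.
  rewrite /lincomb big_ord_recl big_ord1.
  by have -> : lift ord0 ord0 = 1 :> 'I_2 by apply: val_inj.
have [n [f [ef relf]]] : finitely_presented (span e).
  by apply: coh; exists 2, e.
have [k [r rE]] := relations_fg_change_generators (esym ef) relf.
(* The second entry of each generating syzygy is X a for some a in A. *)
have /choice[a aE] j : exists a : A, (r j 0 1)%:A = X *: a.
  have : lincomb e (r j) = 0 by have := span_gen r j; rewrite -rE.
  rewrite relE => /eqP; rewrite addrC addr_eq0 => /eqP rj.
  have [|b ->] := regY (r j 0 1)%:A (- (r j 0 0)%:A).
    by rewrite -scalerAl mul1r mulNr -scalerAl mul1r !scalerA mulrC rj scaleNr.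
  by exists b; rewrite -scalerAr mulr1.
exists k, a; apply/seteqP; split=> // b _.
have [x xE] := support_absorbs_fractions hv hA b X0.
have [y yE] := support_absorbs_fractions hv hA b Y0.
pose c : 'rV[Aplus]_2 := \row_i (if i == 0 then - y else x).
have [w cE] : span r c.
  rewrite -rE; change (lincomb e c = 0); rewrite relE !mxE /= mulNr.
  apply/eqP; rewrite addrC subr_eq0; apply/eqP/(semi_fraction_inj hv hA).
  by rewrite mulrC -scalerA -xE mulrC -scalerA -yE !scalerA mulrC.
(* Compare second entries and cancel X. *)
exists w; apply/eqP; rewrite -subr_eq0; apply/eqP/regXZ/eqP.
rewrite scalerBr subr_eq0 xE; apply/eqP.
have -> : x = c 0 1 by rewrite mxE.
rewrite cE summxE scaler_suml scaler_sumr; apply: eq_bigr => j _.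
by rewrite mxE -scalerA aE !scalerA mulrC.
Qed.
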